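(* Let $\mathbf{G}=(G,\alpha,\deg)$ and $\mathbf{G}'=(G',\alpha',\deg)$ be two MW-graphs with standard weights. Then the following conditions are equivalent: 1. There exists an MW-homomorphism $\pi\colon\mathbf{G}\to\mathbf{G}'$. 2. There exists a measure-preserving MW-homomorphism $\pi\colon\mathbf{G}\to\mathbf{G}'$. 3. There is an equivalence relation $\sim$ on $V(G)$ such that $G'\simeq G/{\sim}$ with $\alpha=\alpha'$, i.e. there is a graph isomorphism $f\colon G/{\sim}\to G'$ with $\alpha_e=\alpha'_{f(e)}$ for all $e\in E(G)=E(G/{\sim})$.
   Context: Graphs: a graph $G=(V,E,\partial)$ consists of disjoint, at most countable sets $V$ (vertices) and $E$ (edges), a map $\partial\colon E\to V\times V$, $\partial e=(\partial_-e,\partial_+e)$, and an involution $e\mapsto\bar e$ on $E$ with $e\neq\bar e$ and $\partial_\pm\bar e=\partial_\mp e$. Loops and multiple edges are allowed; graphs may be infinite and disconnected, but are locally finite: $\deg(v)=|\{e\in E:\partial_-e=v\}|<\infty$. The quotient graph $G/{\sim}$ has vertex set $V/{\sim}$, edge set $E$, and connection map $\widetilde\partial e=([\partial_-e],[\partial_+e])$. A graph homomorphism $\pi\colon G\to G'$ consists of maps $\pi\colon V\to V'$, $\pi\colon E\to E'$ with $\pi(\partial_\pm e)=\partial'_\pm(\pi e)$ for all $e\in E$; it is an isomorphism if both maps are bijective. A magnetic potential is a map $\alpha\colon E\to R$ with $\alpha_{\bar e}=-\alpha_e$, $R$ a fixed subgroup of $\mathbb{R}/2\pi\mathbb{Z}$.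 Standard weights: vertex weight $w(v)=\deg(v)$ (required positive, so there are no isolated vertices), edge weight $w_e=1$. An MW-homomorphism $\pi\colon(G,\alpha,w)\to(G',\alpha',w')$ is a graph homomorphism with $\alpha_e=\alpha'_{\pi e}$ for all $e\in E$, $\sum_{v\in V,\pi(v)=v'}w(v)\ge w'(v')$ for all $v'\in V'$, and $\sum_{e\in E,\pi(e)=e'}w_e\le w'_{e'}$ for all $e'\in E'$. It is measure preserving if equality holds in both weight conditions for all $v'\in V'$ and all $e'\in E'$. *)

(* Defs.v *)
From HB Require Import structures.
From mathcomp Require Import all_boot all_order all_algebra.
From mathcomp Require Import generic_quotient ring_quotient finmap.
From mathcomp Require Import all_classical all_reals all_analysis.

Set Implicit Arguments.
Unset Strict Implicit.
Unset Printing Implicit Defensive.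

Import Order.TTheory GRing.Theory Num.Theory.
Local Open Scope classical_set_scope.
Local Open Scope ring_scope.
Local Open Scope quotient_scope.

Definition two_pi_int (R : realType) : {pred R} :=
  fun x => `[< exists k : int, x = (pi *+ 2) *~ k >].
Arguments two_pi_int R x : clear implicits.

Fact two_pi_int_zmod_closed (R : realType) : zmod_closed (two_pi_int R).
Proof.
split; first by apply/asboolP; exists 0; rewrite mulr0z.
move=> x y /asboolP[k ->] /asboolP[l ->].
by apply/asboolP; exists (k - l); rewrite mulrzBr.
Qed.

HB.instance Definition _ (R : realType) :=
  GRing.isZmodClosed.Build R (two_pi_int R) (two_pi_int_zmod_closed R).

(* The additive group R / 2 pi Z. *)
Definition circle (R : realType) : zmodType :=
  Quotient.quot (two_pi_int R).

(* Local finiteness is not part of [graph], because a quotient of a locally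
   finite graph need not be locally finite; it is a field of [mwgraph]. *)
Record graph := Graph {
  vertex : countType;
  edge : countType;
  bd : edge -> vertex * vertex;
  ebar : edge -> edge;
  ebarK : involutive ebar;
  ebar_neq : forall e, e <> ebar e;
  bd_ebar : forall e, bd (ebar e) = ((bd e).2, (bd e).1) }.

Definition bdm (G : graph) (e : edge G) : vertex G := (bd e).1.
Definition bdp (G : graph) (e : edge G) : vertex G := (bd e).2.

Definition out_edges (G : graph) (v : vertex G) : set (edge G) :=
  [set e | bdm e = v].

Definition locally_finite (G : graph) :=
  forall v : vertex G, finite_set (out_edges v).

(* [fset_set] of an infinite set is empty, so this is the degree only when
   [out_edges v] is finite. *)
Definition deg (G : graph) (v : vertex G) : nat := #|` fset_set (out_edges v)|.

Definition quot_bd (G : graph) (r : equiv_rel (vertex G)) (e : edge G) :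
    {eq_quot r} * {eq_quot r} :=
  (\pi_({eq_quot r}) (bdm e), \pi_({eq_quot r}) (bdp e)).

Fact quot_bd_ebar (G : graph) (r : equiv_rel (vertex G)) (e : edge G) :
  quot_bd r (ebar e) = ((quot_bd r e).2, (quot_bd r e).1).
Proof. by rewrite /quot_bd /bdm /bdp bd_ebar. Qed.

Definition quot_graph (G : graph) (r : equiv_rel (vertex G)) : graph :=
  @Graph {eq_quot r} (edge G) (quot_bd r) (@ebar G) (@ebarK G)
    (@ebar_neq G) (quot_bd_ebar r).

(* No compatibility with [ebar] is required of a homomorphism. *)
Record graph_hom (G G' : graph) := GraphHom {
  hom_vertex : vertex G -> vertex G';
  hom_edge : edge G -> edge G';
  hom_bdm : forall e, hom_vertex (bdm e) = bdm (hom_edge e);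
  hom_bdp : forall e, hom_vertex (bdp e) = bdp (hom_edge e) }.

Definition graph_iso (G G' : graph) (f : graph_hom G G') :=
  bijective (hom_vertex f) /\ bijective (hom_edge f).

(* Magnetic weighted graphs; the magnetic potential takes its values in the
   subgroup [A] of R / 2 pi Z. *)
Record mwgraph (R : realType) (A : zmodClosed (circle R)) := MWGraph {
  mwg :> graph;
  mwg_locally_finite : locally_finite mwg;
  potential : edge mwg -> circle R;
  potential_in : forall e, potential e \in A;
  potential_ebar : forall e, potential (ebar e) = - potential e;
  vweight : vertex mwg -> R;
  vweight_gt0 : forall v, 0 < vweight v;
  eweight : edge mwg -> R;
  eweight_gt0 : forall e, 0 < eweight e;
  eweight_ebar : forall e, eweight (ebar e) = eweight e }.

(* Together with [vweight_gt0], this excludes isolated vertices. *)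
Definition standard_weights (R : realType) (A : zmodClosed (circle R))
    (G : mwgraph A) :=
  (forall v : vertex G, vweight v = (deg v)%:R) /\
  (forall e : edge G, eweight e = 1).

(* The fibres of a homomorphism may be infinite, hence the sums in [\bar R]. *)
Section MWHomomorphisms.
Context (R : realType) (A : zmodClosed (circle R)) (G G' : mwgraph A).
Variable f : graph_hom G G'.

Definition vfibre_weight (v' : vertex G') : \bar R :=
  \esum_(v in [set v | hom_vertex f v = v']) (vweight v)%:E.

Definition efibre_weight (e' : edge G') : \bar R :=
  \esum_(e in [set e | hom_edge f e = e']) (eweight e)%:E.

Definition mw_hom :=
  [/\ forall e, potential e = potential (hom_edge f e),
      forall v', ((vweight v')%:E <= vfibre_weight v')%E
    & forall e', (efibre_weight e' <= (eweight e')%:E)%E].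

Definition measure_preserving :=
  (forall v', vfibre_weight v' = (vweight v')%:E) /\
  (forall e', efibre_weight e' = (eweight e')%:E).

End MWHomomorphisms.

(* Main.v *)
Require Import Defs.
From mathcomp Require Import all_boot all_order all_algebra.
From mathcomp Require Import generic_quotient finmap.
From mathcomp Require Import all_classical all_reals all_analysis.

(** Everything reduces to the edge fibres. With standard weights the weight of
    a vertex counts the edges leaving it, so the weight of the fibre over [v']
    counts the edges [e] of [G] for which [f e] leaves [v']; grouping these by
    their image [f e] instead of their origin gives
    [vfibre_weight_edges]: the weight of the fibre over [v'] is the sum of the
    weights of the fibres over the edges [e'] leaving [v'].

    For an MW-homomorphism each of these edge fibres has weight at most 1,
    while their sum is at least the number [deg v'] of terms. As [deg v'] is
    finite, all the inequalities are equalities, and [f] is measure preserving.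
    An edge fibre has weight 1 exactly when it is a singleton, so a measure
    preserving [f] is bijective on edges
    ([hom_edge_bijective_efibre]); it is onto on vertices because no vertex of
    [G'] is isolated, hence it becomes an isomorphism after dividing [G] by the
    kernel of [f] on vertices. Conversely the projection of [G] to a quotient
    isomorphic to [G'] is bijective on edges, so that all edge fibres have
    weight 1, and by the double counting all vertex weights agree. *)

Set Implicit Arguments.
Unset Strict Implicit.
Unset Printing Implicit Defensive.

Import Order.TTheory GRing.Theory Num.Theory.
Local Open Scope classical_set_scope.
Local Open Scope ring_scope.

Lemma esum_cst1 (R : realType) (T : choiceType) (S : set T) :
  finite_set S -> \esum_(i in S) 1%E = (#|` fset_set S|%:R)%:E :> \bar R.
Proof.
move=> finS; rewrite esum_fset// fsbig_finite//= sumEFin.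
by rewrite big_const_seq count_predT iter_addr_0.
Qed.

Lemma esum_fibres (R : realType) (T I : choiceType) (g : T -> I) (K : set I)
    (a : T -> \bar R) :
  (forall t, 0 <= a t)%E ->
  \esum_(i in K) \esum_(t in [set t | g t = i]) a t =
  \esum_(t in g @^-1` K) a t.
Proof.
move=> a0; rewrite esum_esum//.
apply: (reindex_esum _ _ (fun t => (g t, t))); split=> [t Kt//|s t _ _ []//|].
by move=> [i t] [/= Ki gt]; exists t; rewrite /= gt.
Qed.

Lemma esum_setD1 (R : realType) (T : choiceType) (S : set T) (i : T)
    (a : T -> \bar R) :
  S i -> (forall j, S j -> 0 <= a j)%E ->
  \esum_(j in S) a j = (a i + \esum_(j in S `&` ~` [set i]) a j)%E.
Proof.
move=> Si a0; rewrite (esumID [set i] S a)// (_ : S `&` [set i] = [set i]).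
  by rewrite esum_set1// a0.
by apply/seteqP; split=> [j []//|j ->].
Qed.

(** A single strict inequality would survive the summation, since the other
    terms have a finite sum. *)
Lemma esum_le_eq (R : realType) (T : choiceType) (S : set T)
    (a b : T -> \bar R) :
  (forall i, S i -> 0 <= a i)%E -> (forall i, S i -> a i <= b i)%E ->
  \esum_(i in S) b i \is a fin_num ->
  (\esum_(i in S) b i <= \esum_(i in S) a i)%E ->
  forall i, S i -> a i = b i.
Proof.
move=> a0 ab finb ba i Si.
have b0 j : S j -> (0 <= b j)%E.
  by move=> Sj; exact: le_trans (a0 j Sj) (ab j Sj).
apply/eqP; rewrite eq_le ab//= leNgt; apply/negP => lt_ab.
move: ba finb; rewrite (esum_setD1 (a := a) Si)// (esum_setD1 (a := b) Si)//.
set B := esum _ b; set A := esum _ a => ba.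
rewrite fin_numD => /andP[_ finB].
have AB : (A <= B)%E by apply: le_esum => j [/ab].
have finA : A \is a fin_num.
  rewrite ge0_fin_numE ?(le_lt_trans AB) ?ltey_eq ?finB//.
  by apply: esum_ge0 => j [/a0].
by move: ba; rewrite leNgt lte_leD.
Qed.

Section Fibres.
Context (R : realType) (A : zmodClosed (circle R)) (G G' : mwgraph A).
Hypothesis hG : standard_weights G.
Variable f : graph_hom G G'.

Lemma efibre_weight_ge0 e' : (0 <= efibre_weight f e')%E.
Proof. by apply: esum_ge0 => e _; rewrite lee_fin ltW// eweight_gt0. Qed.

Lemma vweight_out_edges (v : vertex G) :
  (vweight v)%:E = \esum_(e in out_edges v) (eweight e)%:E.
Proof.
rewrite hG.1 -esum_cst1; last exact: mwg_locally_finite.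
by apply: eq_esum => e _; rewrite hG.2.
Qed.

(** Both sides count the edges [e] with [f (bdm e) = v'], grouped on the left
    by [bdm e] and on the right by [f e]. *)
Lemma vfibre_weight_edges v' :
  vfibre_weight f v' = \esum_(e' in out_edges v') efibre_weight f e'.
Proof.
have w0 (e : edge G) : (0 <= (eweight e)%:E)%E.
  by rewrite lee_fin ltW// eweight_gt0.
rewrite /vfibre_weight.
under eq_esum do rewrite vweight_out_edges.
rewrite /efibre_weight (esum_fibres (@bdm G))// (esum_fibres (hom_edge f))//.
by congr esum; apply/seteqP; split=> e; rewrite /out_edges /= hom_bdm.
Qed.

Lemma hom_edge_bijective_efibre :
  bijective (hom_edge f) <-> forall e', efibre_weight f e' = 1%E.
Proof.
have w1 (e : edge G) : (eweight e)%:E = 1%E :> \bar R by rewrite hG.2.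
split=> [[g fK gK] e'|fib1].
  rewrite /efibre_weight (_ : [set _ | _] = [set g e']).
    by rewrite esum_set1 w1.
  by apply/seteqP; split=> e /= => [<-|->]; rewrite ?fK ?gK.
rewrite -setTT_bijective; split=> // [e1 e2 _ _ fe12|e' _].
  apply: contrapT => /eqP ne12; have := fib1 (hom_edge f e2).
  rewrite /efibre_weight (esum_setD1 (i := e1)) ?w1//; last first.
    by move=> e _; rewrite w1.
  move=> sum1.
  (* What is left of the fibre still contains [e2]: the total is at least 2. *)
  suff : (1 + 1 <= 1 :> \bar R)%E by rewrite -EFinD lee_fin gerDl ler10.
  rewrite -[leRHS]sum1 leeD2l//; apply: esum_ge; exists [set e2].
    split; first exact: finite_set1.
    by move=> e ->; split=> // /esym/eqP; rewrite (negbTE ne12).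
  by rewrite fsbig_set1 w1.
have : efibre_weight f e' != 0 by rewrite fib1 onee_neq0.
apply: contraPP => nfe' /eqP; apply.
by rewrite /efibre_weight esum1// => e fe; case: nfe'; exists e.
Qed.

End Fibres.

Section StandardWeights.
Context (R : realType) (A : zmodClosed (circle R)) (G G' : mwgraph A).
Hypotheses (hG : standard_weights G) (hG' : standard_weights G').

Lemma mw_hom_efibre (f : graph_hom G G') :
  mw_hom f -> forall e', efibre_weight f e' = 1%E.
Proof.
case=> _ fv fe e'; rewrite -(hG'.2 e').
apply: (esum_le_eq (S := out_edges (bdm e')) (b := fun e => (eweight e)%:E)).
- by move=> e _; exact: efibre_weight_ge0.
- by move=> e _; exact: fe.
- by rewrite -vweight_out_edges.
- by rewrite -vweight_out_edges// -vfibre_weight_edges.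
- by [].
Qed.

Lemma efibre_measure_preserving (f : graph_hom G G') :
  (forall e', efibre_weight f e' = 1%E) -> measure_preserving f.
Proof.
move=> fib1; split=> [v'|e']; last by rewrite fib1 hG'.2.
rewrite vfibre_weight_edges// vweight_out_edges//.
by apply: eq_esum => e' _; rewrite fib1 hG'.2.
Qed.

Lemma measure_preserving_mw_hom (f : graph_hom G G') :
  (forall e, potential e = potential (hom_edge f e)) ->
  measure_preserving f -> mw_hom f.
Proof. by move=> fpot [fv fe]; split=> // [v'|e']; rewrite (fv, fe). Qed.

(** Vertex weights are positive degrees, so each vertex of [G'] is the origin
    of an edge, and an edge preimage has its own origin above that vertex. *)
Lemma hom_vertex_surj (f : graph_hom G G') :
  bijective (hom_edge f) -> forall v', exists v, hom_vertex f v = v'.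
Proof.
move=> [g _ gK] v'.
have [e' <-] : out_edges v' !=set0.
  apply/set0P/eqP => out0; have := vweight_gt0 v'.
  by rewrite hG'.1 /deg out0 fset_set0 cardfs0 ltxx.
by exists (bdm (g e')); rewrite hom_bdm gK.
Qed.

End StandardWeights.

Definition quot_proj_hom (G G' : graph) (r : equiv_rel (vertex G))
    (f : graph_hom (quot_graph r) G') : graph_hom G G' :=
  @GraphHom G G' (fun v => hom_vertex f (\pi_({eq_quot r})%qT v))
    (hom_edge f) (hom_bdm f) (hom_bdp f).

Section Kernel.
Context (G G' : graph) (f : graph_hom G G').

Definition vker (v w : vertex G) := hom_vertex f v == hom_vertex f w.

Fact vker_equiv : equiv_class_of vker.
Proof.
split=> [v|v w|v u w]; rewrite /vker ?eqxx//.
by move=> /eqP -> /eqP ->.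
Qed.

Definition vker_rel : equiv_rel (vertex G) := EquivRelPack vker_equiv.

Lemma hom_vertex_repr v :
  hom_vertex f (repr (\pi_({eq_quot vker_rel})%qT v)) = hom_vertex f v.
Proof.
apply/eqP; have := reprK (\pi_({eq_quot vker_rel})%qT v).
by move/eqmodP.
Qed.

Fact vker_hom_bdm (e : edge (quot_graph vker_rel)) :
  hom_vertex f (repr (bdm e)) = bdm (hom_edge f e).
Proof. by rewrite -hom_bdm -[RHS]hom_vertex_repr. Qed.

Fact vker_hom_bdp (e : edge (quot_graph vker_rel)) :
  hom_vertex f (repr (bdp e)) = bdp (hom_edge f e).
Proof. by rewrite -hom_bdp -[RHS]hom_vertex_repr. Qed.

Definition vker_hom : graph_hom (quot_graph vker_rel) G' :=
  @GraphHom (quot_graph vker_rel) G' (fun q => hom_vertex f (repr q))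
    (hom_edge f) vker_hom_bdm vker_hom_bdp.

Lemma vker_hom_iso :
  (forall v', exists v, hom_vertex f v = v') -> bijective (hom_edge f) ->
  graph_iso vker_hom.
Proof.
move=> fsurj fbij; split=> //; rewrite -setTT_bijective; split=> //.
- move=> p q _ _ /= fpq; rewrite -[p]reprK -[q]reprK.
  by apply/eqmodP/eqP.
- move=> v' _; have [v <-] := fsurj v'.
  by exists (\pi_({eq_quot vker_rel})%qT v) => //=; rewrite hom_vertex_repr.
Qed.

End Kernel.

Theorem proposition2p18 (R : realType) (A : zmodClosed (circle R))
    (G G' : mwgraph A)
    (hG : standard_weights G) (hG' : standard_weights G') :
  [<-> (* 1 *)
       exists f : graph_hom G G', mw_hom f;
       (* 2 *)
       exists f : graph_hom G G', mw_hom f /\ measure_preserving f;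
       (* 3 *)
       exists (r : equiv_rel (vertex G)) (f : graph_hom (quot_graph r) G'),
         graph_iso f /\
         forall e : edge G, potential e = potential (hom_edge f e)].
Proof.
tfae.
- move=> [f fmw]; exists f; split=> //.
  by apply: efibre_measure_preserving => //; exact: mw_hom_efibre.
- move=> [f [fmw _]]; exists (vker_rel f), (vker_hom f).
  have fbij : bijective (hom_edge f).
    by apply/(hom_edge_bijective_efibre hG); exact: mw_hom_efibre.
  split; last by case: fmw.
  by apply: vker_hom_iso => //; exact: hom_vertex_surj.
- move=> [r [f [[_ fbij] fpot]]]; exists (quot_proj_hom f).
  apply: measure_preserving_mw_hom => //.
  apply: efibre_measure_preserving => //.
  exact/(hom_edge_bijective_efibre hG (quot_proj_hom f)).
Qed.
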